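(* Let $G$ be a Lie group. A smooth map $\mathfrak{B}:G\to G$ is a Rota-Baxter operator on $G$ if and only if its graph $\mathcal{G}_{\mathfrak{B}}:=\{(\mathfrak{B}(g),g)\mid g\in G\}$ is a Lie subgroup of $G\triangleright G$.
   Context: For a group $G$, $\mathrm{Ad}_g h:=ghg^{-1}$. A Rota-Baxter operator on a Lie group $G$ is a smooth map $\mathfrak{B}:G\to G$ such that $\mathfrak{B}(g_1)\mathfrak{B}(g_2)=\mathfrak{B}(g_1\,\mathrm{Ad}_{\mathfrak{B}(g_1)}g_2)$ for all $g_1,g_2\in G$. $G\triangleright G$ denotes the Lie group on the manifold $G\times G$ with multiplication $(g_1,h_1)\cdot(g_2,h_2):=(g_1g_2,\,h_1\,\mathrm{Ad}_{g_1}h_2)$. *)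

(* Defs.v *)
From HB Require Import structures.
From mathcomp Require Import all_boot all_order all_algebra.
From mathcomp Require Import all_classical all_reals all_analysis.
Import Order.TTheory GRing.Theory Num.Theory numFieldNormedType.Exports.

Set Implicit Arguments.
Unset Strict Implicit.
Unset Printing Implicit Defensive.

Local Open Scope classical_set_scope.
Local Open Scope ring_scope.

Section Ck.
Context {R : realType}.

(* For finite-dimensional V, f is of class C^(k+1) on the open set U iff it is
   Frechet differentiable there and x |-> df_x is of class C^k, which amounts
   to x |-> df_x(v) being of class C^k for each vector v. *)
Fixpoint Ck (V W : normedModType R) (k : nat) (U : set V) (f : V -> W) : Prop :=
  if k is k'.+1 then
    (forall x, U x -> differentiable f x) /\
    (forall v, Ck k' U (fun x => 'd f x v))
  else forall x, U x -> {for x, continuous f}.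

Definition smooth_on (V W : normedModType R) (U : set V) (f : V -> W) :=
  forall k, Ck k U f.

Implicit Types V W : normedModType R.

Lemma is_diff_near V W (f g : V -> W) (x : V) :
  (\forall y \near x, f y = g y) -> differentiable f x -> is_diff x g ('d f x).
Proof.
move=> fg df.
have gdf : g \o shift x = cst (g x) + 'd f x +o_ 0 id.
  have := diff_locally df; rewrite (nbhs_singleton fg).
  move=> /eqaddoP h; apply/eqaddoP => e e0.
  have fg0 : \forall y \near (0 : V), f (y + x) = g (y + x).
    by move: fg; rewrite (near_shift 0 x) subr0.
  apply: filterS2 (h e e0) fg0 => y hy fgy.
  by rewrite -[X in `|X|]/(g (y + x) - (cst (g x) + 'd f x) y) -fgy.
have dgE := diff_unique (diff_continuous df) gdf.
apply: DiffDef; last by [].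
by apply/diff_locallyP; rewrite dgE; split => //; exact: diff_continuous.
Qed.

Lemma eq_Ck V W k (U : set V) (f g : V -> W) : open U ->
  (forall x, U x -> f x = g x) -> Ck k U f -> Ck k U g.
Proof.
move=> oU; have nU (x : V) (h1 h2 : V -> W) : U x ->
    (forall y, U y -> h1 y = h2 y) -> \forall y \near x, h1 y = h2 y.
  by move=> Ux h; apply: filterS (open_nbhs_nbhs (conj oU Ux)) => y /h.
elim: k f g => [|k IH] f g fg /= Cf.
  move=> x Ux; rewrite /prop_for /continuous_at -fg //.
  by apply: cvg_trans (Cf x Ux); apply: near_eq_cvg; exact: nU.
case: Cf => df Cf; split=> [x Ux|v].
  by case: (is_diff_near (nU x _ _ Ux fg) (df x Ux)).
apply: IH (Cf v) => x Ux.
by have [_ ->] := is_diff_near (nU x _ _ Ux fg) (df x Ux).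
Qed.

Lemma CkS V W k (U : set V) (f : V -> W) : Ck k.+1 U f -> Ck k U f.
Proof.
elim: k f => [|k IH] f /= [df Cf]; first by move=> x /df /differentiable_continuous.
by split=> // v; exact: IH (Cf v).
Qed.

Lemma Ck_sub V W k (U U' : set V) (f : V -> W) :
  U' `<=` U -> Ck k U f -> Ck k U' f.
Proof.
move=> sU; elim: k f => [|k IH] f /=; first by move=> h x /sU; exact: h.
by case=> df Cf; split=> [x /sU /df //|v]; apply: IH.
Qed.

Lemma Ck_local V W k (U : set V) (f : V -> W) :
  (forall x, U x -> exists2 U', U' x & Ck k U' f) -> Ck k U f.
Proof.
elim: k f => [|k IH] f /= h; first by move=> x /h [U' U'x]; apply.
split=> [x /h [U' U'x [df _]]|v]; first exact: df.
by apply: IH => x /h [U' U'x [_ Cf]]; exists U'.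
Qed.

Lemma Ck_cst V W k (U : set V) (c : W) : Ck k U (cst c).
Proof.
elim: k c => [|k IH] c /=; first by move=> x _; exact: cvg_cst.
split=> [x _|v]; first exact: differentiable_cst.
by under eq_fun do rewrite diff_cst; exact: IH.
Qed.

Lemma Ck_lin V W k (U : set V) (L : {linear V -> W}) :
  continuous L -> Ck k U L.
Proof.
move=> cL; case: k => [|k] /=; first by move=> x _; exact: cL.
split=> [x _|v]; first exact: linear_differentiable.
by under eq_fun do rewrite diff_lin//; exact: Ck_cst.
Qed.

Lemma Ck_lincomp V W (W' : normedModType R) k (U : set V) (f : V -> W)
  (L : {linear W -> W'}) : open U ->
  continuous L -> Ck k U f -> Ck k U (fun x => L (f x)).
Proof.
move=> oU cL; elim: k f => [|k IH] f /=.
  by move=> Cf x Ux; apply: continuous_comp (Cf x Ux) (cL _).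
case=> df Cf; have dL y : differentiable L y by exact: linear_differentiable.
split=> [x Ux|v]; first exact: differentiable_comp (df x Ux) (dL _).
apply: eq_Ck (IH _ (Cf v)) => // x Ux.
have E := @diff_comp _ _ _ _ f L x (df x Ux) (dL _).
by have := congr1 (@^~ v) E; rewrite /= diff_lin.
Qed.

Lemma CkD V W k (U : set V) (f g : V -> W) : open U ->
  Ck k U f -> Ck k U g -> Ck k U (f + g).
Proof.
move=> oU; elim: k f g => [|k IH] f g /=.
  by move=> Cf Cg x Ux; apply: continuousD; [exact: Cf|exact: Cg].
move=> [df Cf] [dg Cg]; split=> [x Ux|v].
  by apply: differentiableD; [exact: df|exact: dg].
apply: eq_Ck (IH _ _ (Cf v) (Cg v)) => // x Ux.
by rewrite (diffD (df x Ux) (dg x Ux)).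
Qed.

Lemma Ck_sum V W k (U : set V) n (f : 'I_n -> V -> W) : open U ->
  (forall i, Ck k U (f i)) -> Ck k U (\sum_(i < n) f i).
Proof.
by move=> oU Cf; elim/big_ind: _ => [|g h Cg Ch|//];
  [exact: (@Ck_cst _ _ k U 0)|exact: CkD].
Qed.

Lemma scale_is_bilinear W : bilinear_for
  (GRing.Scale.Law.clone _ _ *:%R _) (GRing.Scale.Law.clone _ _ *:%R _)
  (fun (a : R) (w : W) => a *: w).
Proof.
split=> [u'|u] a x y /=; first by rewrite scalerDl -scalerA.
by rewrite scalerDr !scalerA mulrC.
Qed.

Lemma is_diff_scale V W (a : V -> R) (b : V -> W) x :
  differentiable a x -> differentiable b x ->
  is_diff x (fun y => a y *: b y) (fun v => a x *: 'd b x v + 'd a x v *: b x).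
Proof.
move=> da db.
pose sM := bilinear_isBilinear.Build R R W W _ _ _ (@scale_is_bilinear W).
pose s : {bilinear R -> W -> W} := HB.pack (fun (a : R) (w : W) => a *: w) sM.
have cs : continuous (fun p : R * W => s p.1 p.2).
  by move=> p; exact: scale_continuous.
have E : (fun y => a y *: b y) = (fun p : R * W => s p.1 p.2) \o
  (fun y => (a y, b y)) by [].
have dp := differentiable_pair da db.
apply: DiffDef.
  by rewrite E; apply: differentiable_comp => //; exact: differentiable_bilin.
rewrite E diff_comp //; last exact: differentiable_bilin.
by rewrite diff_bilin // diff_pair.
Qed.

Lemma CkZ V W k (U : set V) (a : V -> R) (b : V -> W) : open U ->
  Ck k U a -> Ck k U b -> Ck k U (fun x => a x *: b x).
Proof.
move=> oU; elim: k a b => [|k IH] a b.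
  move=> /= Ca Cb x Ux.
  by apply: (@cvgZ _ _ _ _ _ a b); [exact: Ca|exact: Cb].
move=> C1a C1b; have Ca := CkS C1a; have Cb := CkS C1b.
case: C1a => da Cda; case: C1b => db Cdb; split=> [x Ux|v].
  by case: (is_diff_scale (da x Ux) (db x Ux)).
apply: eq_Ck (CkD oU (IH _ _ Ca (Cdb v)) (IH _ _ (Cda v) Cb)) => // x Ux.
by have [_ ->] := is_diff_scale (da x Ux) (db x Ux).
Qed.

End Ck.

Section CkRow.
Context {R : realType}.
Implicit Types (V W : normedModType R).

Lemma mx_continuous_at (T : topologicalType) m n (f : T -> 'M[R]_(m, n)) x :
  (forall i j, {for x, continuous (fun y => f y i j)}) -> {for x, continuous f}.
Proof.
move=> cf A [P nP sPA].
have : \forall y \near x, forall ij : 'I_m * 'I_n, P ij.1 ij.2 (f y ij.1 ij.2).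
  by apply: filter_forall => -[i j]; exact: cf (nP i j).
by apply: filterS => y Py; apply: sPA => i j; exact: (Py (i, j)).
Qed.

Lemma mulmxr_continuous n p (A : 'M[R]_(n, p)) :
  continuous (mulmxr A : 'rV[R]_n -> 'rV[R]_p).
Proof.
move=> x; apply: mx_continuous_at => i j.
rewrite (_ : (fun _ => _) =
  \sum_(k < n) (fun y : 'rV[R]_n => y i k * A k j)); last first.
  by rewrite funeqE => y; rewrite mxE fct_sumE.
elim/big_ind : _ => [|g h cg ch|k _]; first exact: (@cst_continuous _ _ 0).
  exact: continuousD.
by apply: continuousM; [exact: coord_continuous|exact: cst_continuous].
Qed.

Lemma Ck_row_mx V k (U : set V) m n (f : V -> 'rV[R]_m) (g : V -> 'rV[R]_n) :
  open U -> Ck k U f -> Ck k U g -> Ck k U (fun x => row_mx (f x) (g x)).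
Proof.
move=> oU Cf Cg.
have := CkD oU (Ck_lincomp (L := mulmxr (row_mx 1%:M 0)) oU (@mulmxr_continuous _ _ _) Cf)
  (Ck_lincomp (L := mulmxr (row_mx 0 1%:M)) oU (@mulmxr_continuous _ _ _) Cg).
apply: eq_Ck => // x _ /=.
by rewrite /GRing.add /= !mul_mx_row add_row_mx !mulmx1 !mulmx0 addr0 add0r.
Qed.

Lemma Ck_lsubmx V k (U : set V) m n (f : V -> 'rV[R]_(m + n)) :
  open U -> Ck k U f -> Ck k U (fun x => lsubmx (f x)).
Proof. by move=> oU; apply: Ck_lincomp oU _; exact: continuous_lsubmx. Qed.

Lemma Ck_rsubmx V k (U : set V) m n (f : V -> 'rV[R]_(m + n)) :
  open U -> Ck k U f -> Ck k U (fun x => rsubmx (f x)).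
Proof. by move=> oU; apply: Ck_lincomp oU _; exact: continuous_rsubmx. Qed.

Lemma Ck_coord V k (U : set V) n (f : V -> 'rV[R]_n) i j :
  open U -> Ck k U f -> Ck k U (fun x => f x i j).
Proof.
move=> oU.
have lin : linear (fun u : 'rV[R]_n => u i j) by move=> a u v; rewrite !mxE.
pose M := GRing.isLinear.Build _ _ _ _ _ lin.
pose L : {linear 'rV[R]_n -> R} := HB.pack (fun u : 'rV[R]_n => u i j) M.
by apply: (Ck_lincomp (L := L) oU); exact: coord_continuous.
Qed.

Lemma Ck_comp V W k n (U : set V) (U' : set 'rV[R]_n)
    (f : V -> 'rV[R]_n) (g : 'rV[R]_n -> W) : open U ->
  (forall x, U x -> U' (f x)) -> Ck k U f -> Ck k U' g -> Ck k U (g \o f).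
Proof.
move=> oU sU; elim: k g => [|k IH] g.
  by move=> Cf Cg x Ux; apply: continuous_comp (Cf x Ux) (Cg _ (sU x Ux)).
move=> C1f [dg Cg]; have Cf := CkS C1f; case: C1f => df Cdf; split=> [x Ux|v].
  by apply: differentiable_comp; [exact: df|exact/dg/sU].
have : Ck k U (\sum_(i < n) fun x => 'd f x v 0 i *: 'd g (f x) (delta_mx 0 i)).
  by apply: Ck_sum => // i; apply: CkZ => //; [exact: Ck_coord (Cdf v)|exact: IH Cf (Cg _)].
apply: eq_Ck => // x Ux.
rewrite (@diff_comp _ _ _ _ f g x (df x Ux) (dg _ (sU x Ux))) /=.
rewrite fct_sumE [in RHS](row_sum_delta ('d f x v)) linear_sum.
by apply: eq_bigr => i _; rewrite linearZ.
Qed.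

End CkRow.

(* chart_inv is total; only its values on the image of chart_dom matter. As
   chart_dom and that image are open, pointwise continuity at their points is
   continuity of the chart and of its inverse as maps between open sets. *)
Record chart (R : realType) (n : nat) (M : topologicalType) := Chart {
  chart_dom : set M;
  chart_map :> M -> 'rV[R]_n;
  chart_inv : 'rV[R]_n -> M;
  chart_dom_open : open chart_dom;
  chart_cod_open : open (chart_map @` chart_dom);
  chartK : forall x, chart_dom x -> chart_inv (chart_map x) = x;
  chart_continuous : forall x, chart_dom x -> {for x, continuous chart_map};
  chart_inv_continuous : forall x, chart_dom x ->
    {for chart_map x, continuous chart_inv} }.

(* The atlas need not be maximal: the notions below are invariant under adding
   compatible charts. *)
HB.mixin Record Topological_isManifold (R : realType) (n : nat) (M : Type)
    of Topological M := {
  atlas : set (chart R n M);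
  atlas_cover : forall x : M, exists2 c, atlas c & chart_dom c x;
  atlas_compat : forall c d, atlas c -> atlas d ->
    smooth_on (c @` (chart_dom c `&` chart_dom d)) (d \o chart_inv c);
  manifold_hausdorff : hausdorff_space M;
  manifold_second_countable : @second_countable M }.

#[short(type="manifoldType")]
HB.structure Definition Manifold (R : realType) (n : nat) :=
  {M of Topological M & Topological_isManifold R n M}.

Section SmoothMap.
Context {R : realType} {m n : nat}.

Definition smooth_map (M : manifoldType R m) (N : manifoldType R n)
    (f : M -> N) :=
  continuous f /\
  forall (c : chart R m M) (d : chart R n N), atlas c -> atlas d ->
    smooth_on (c @` (chart_dom c `&` f @^-1` chart_dom d))
              (d \o f \o chart_inv c).

Definition immersion (M : manifoldType R m) (N : manifoldType R n)
    (f : M -> N) :=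
  smooth_map f /\
  forall (c : chart R m M) (d : chart R n N) x, atlas c -> atlas d ->
    chart_dom c x -> chart_dom d (f x) ->
    injective ('d (d \o f \o chart_inv c) (c x)).

End SmoothMap.

Section ChartTheory.
Context {R : realType} {n : nat} {M : topologicalType}.
Implicit Types c : chart R n M.

Lemma chart_open c (U : set M) : open U -> open (c @` (chart_dom c `&` U)).
Proof.
move=> oU; rewrite openE => _ [x [cx Ux] <-].
have nU : nbhs (c x) (chart_inv c @^-1` U).
  apply: (chart_inv_continuous cx); rewrite chartK//.
  exact: open_nbhs_nbhs.
have nc : nbhs (c x) (c @` chart_dom c).
  by apply: open_nbhs_nbhs; split; [exact: chart_cod_open|exists x].
apply: filterS2 nU nc => z Uz [y cy yz]; exists y => //; split=> //.
by move: Uz; rewrite -yz /= chartK.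
Qed.

End ChartTheory.

Section SmoothMapTheory.
Context {R : realType}.

Lemma smooth_map_id m (M : manifoldType R m) : smooth_map (@id M).
Proof. by split=> [x|c d ac ad]; [exact: cvg_id|exact: atlas_compat]. Qed.

Lemma smooth_map_cst m n (M : manifoldType R m) (N : manifoldType R n) (y : N) :
  smooth_map (fun _ : M => y).
Proof. by split=> [x|c d _ _ k]; [exact: cvg_cst|exact: Ck_cst]. Qed.

Lemma smooth_map_comp m n p (M : manifoldType R m) (N : manifoldType R n)
    (P : manifoldType R p) (f : M -> N) (g : N -> P) :
  smooth_map f -> smooth_map g -> smooth_map (g \o f).
Proof.
move=> [cf sf] [cg sg]; split=> [x|c e ac ae k].
  exact: continuous_comp (cf x) (cg _).
have cgf x : {for x, continuous (g \o f)} by exact: continuous_comp (cf x) (cg _).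
have oe : open ((g \o f) @^-1` chart_dom e).
  by apply: open_comp; [move=> x _; exact: cgf|exact: chart_dom_open].
apply: Ck_local => _ [x [cx ex] <-].
have [d ad dfx] := atlas_cover (f x).
have od : open (f @^-1` chart_dom d).
  by apply: open_comp; [move=> y _; exact: cf|exact: chart_dom_open].
exists (c @` (chart_dom c `&` (f @^-1` chart_dom d `&` (g \o f) @^-1` chart_dom e))).
  by exists x.
set U := c @` _.
have oU : open U by apply: chart_open; exact: openI.
have Cf : Ck k U (d \o f \o chart_inv c).
  by apply: Ck_sub (sf c d ac ad k) => _ [y [cy [dy _]] <-]; exists y.
have := Ck_comp oU _ Cf (sg d e ad ae k).
have h z : U z -> (d @` (chart_dom d `&` g @^-1` chart_dom e))
    ((d \o f \o chart_inv c) z).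
  by move=> [y [cy [dy ey]] <-]; exists (f y) => //=; rewrite chartK.
move=> /(_ h); apply: eq_Ck => // _ [y [cy [dy ey]] <-] /=.
by rewrite chartK// chartK.
Qed.

End SmoothMapTheory.

Lemma open_setX (M N : topologicalType) (A : set M) (B : set N) :
  open A -> open B -> open (A `*` B).
Proof.
move=> oA oB; rewrite openE => -[x y] [/= Ax By]; exists (A, B) => //.
by split; exact: open_nbhs_nbhs.
Qed.

Section ProdChart.
Context {R : realType} {m n : nat} {M N : topologicalType}.
Variables (c : chart R m M) (d : chart R n N).

Definition prod_chart_dom : set (M * N) := chart_dom c `*` chart_dom d.
Definition prod_chart_map (p : M * N) := row_mx (c p.1) (d p.2).
Definition prod_chart_inv (z : 'rV[R]_(m + n)) : M * N :=
  (chart_inv c (lsubmx z), chart_inv d (rsubmx z)).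

Lemma prod_chart_dom_open : open prod_chart_dom.
Proof. by apply: open_setX; exact: chart_dom_open. Qed.

Lemma prod_chart_codE : prod_chart_map @` prod_chart_dom =
  lsubmx @^-1` (c @` chart_dom c) `&` rsubmx @^-1` (d @` chart_dom d).
Proof.
apply/seteqP; split=> [_ [[x y] [/= cx dy] <-]|z [[x cx xz] [y dy yz]]].
  by rewrite /prod_chart_map /=; split; rewrite /= ?row_mxKl ?row_mxKr;
    [exists x|exists y].
by exists (x, y) => //; rewrite /prod_chart_map /= xz yz hsubmxK.
Qed.

Lemma prod_chart_cod_open : open (prod_chart_map @` prod_chart_dom).
Proof.
rewrite prod_chart_codE; apply: openI; (apply: open_comp; last exact: chart_cod_open).
  by move=> x _; exact: continuous_lsubmx.
by move=> x _; exact: continuous_rsubmx.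
Qed.

Lemma prod_chartK p : prod_chart_dom p ->
  prod_chart_inv (prod_chart_map p) = p.
Proof.
case: p => x y [/= cx dy].
by rewrite /prod_chart_inv row_mxKl row_mxKr /= !chartK.
Qed.

Lemma prod_chart_continuous p : prod_chart_dom p ->
  {for p, continuous prod_chart_map}.
Proof.
case: p => x y [/= cx dy]; apply: mx_continuous_at => i j.
case: (split_ordP j) => k ->.
  rewrite (_ : (fun _ => _) = fun p : M * N => c p.1 i k); last first.
    by rewrite funeqE => p; rewrite /prod_chart_map row_mxEl.
  apply: (@continuous_comp _ _ _ (fun p : M * N => c p.1)
    (fun u : 'rV[R]_m => u i k)); last exact: coord_continuous.
  apply: (@continuous_comp _ _ _ (@fst M N) c); first exact: cvg_fst.
  exact: chart_continuous.
rewrite (_ : (fun _ => _) = fun p : M * N => d p.2 i k); last first.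
  by rewrite funeqE => p; rewrite /prod_chart_map row_mxEr.
apply: (@continuous_comp _ _ _ (fun p : M * N => d p.2)
  (fun u : 'rV[R]_n => u i k)); last exact: coord_continuous.
apply: (@continuous_comp _ _ _ (@snd M N) d); first exact: cvg_snd.
exact: chart_continuous.
Qed.

Lemma prod_chart_inv_continuous p : prod_chart_dom p ->
  {for prod_chart_map p, continuous prod_chart_inv}.
Proof.
case: p => x y [/= cx dy]; set z := prod_chart_map _.
have cl : {for z, continuous (fun u : 'rV[R]_(m + n) => chart_inv c (lsubmx u))}.
  apply: (@continuous_comp _ _ _ (fun u : 'rV[R]_(m + n) => lsubmx u)
    (chart_inv c)); first exact: continuous_lsubmx.
  by rewrite /z /prod_chart_map row_mxKl; exact: chart_inv_continuous.
have cr : {for z, continuous (fun u : 'rV[R]_(m + n) => chart_inv d (rsubmx u))}.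
  apply: (@continuous_comp _ _ _ (fun u : 'rV[R]_(m + n) => rsubmx u)
    (chart_inv d)); first exact: continuous_rsubmx.
  by rewrite /z /prod_chart_map row_mxKr; exact: chart_inv_continuous.
exact: (cvg_pair cl cr).
Qed.

Definition prod_chart : chart R (m + n) (M * N)%type :=
  Chart prod_chart_dom_open prod_chart_cod_open prod_chartK
    prod_chart_continuous prod_chart_inv_continuous.

End ProdChart.

Lemma prod_hausdorff (M N : topologicalType) :
  hausdorff_space M -> hausdorff_space N -> hausdorff_space (M * N)%type.
Proof.
have nX (p : M * N) (A : set M) (B : set N) :
    nbhs p.1 A -> nbhs p.2 B -> nbhs p (A `*` B) by move=> nA nB; exists (A, B).
move=> hM hN [x y] [x' y'] xy; congr (_, _).
  apply: hM => A B nA nB.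
  have [[u v] [[Au _] [Bu _]]] := xy (A `*` setT) (B `*` setT)
    (nX (x, y) _ _ nA filterT) (nX (x', y') _ _ nB filterT).
  by exists u.
apply: hN => A B nA nB.
have [[u v] [[_ Av] [_ Bv]]] := xy (setT `*` A) (setT `*` B)
  (nX (x, y) _ _ filterT nA) (nX (x', y') _ _ filterT nB).
by exists v.
Qed.

Lemma prod_second_countable (M N : topologicalType) :
  @second_countable M -> @second_countable N ->
  @second_countable (M * N)%type.
Proof.
move=> [A cA [oA bA]] [B cB [oB bB]].
exists [set U `*` V | U in A & V in B].
  rewrite image2E; apply: sub_countable (countableX cA cB).
  exact: card_image_le.
split=> [_ [U AU [V BV <-]]|[x y] W [[P Q] [/= nP nQ] sPQ]].
  by apply: open_setX; [exact: oA|exact: oB].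
have [U [AU Ux] sU] := bA x P nP; have [V [BV Vy] sV] := bB y Q nQ.
exists (U `*` V); first by split=> //; exists U => //; exists V.
by move=> [u v] [/= Uu Vv]; apply: sPQ; split; [exact: sU|exact: sV].
Qed.

Section ProdManifold.
Context {R : realType} {m n : nat} (M : manifoldType R m) (N : manifoldType R n).

Definition prod_atlas : set (chart R (m + n) (M * N)%type) :=
  [set prod_chart c d | c in @atlas R m M & d in @atlas R n N].

Lemma prod_atlas_cover (p : M * N) : exists2 c, prod_atlas c & chart_dom c p.
Proof.
have [c ac cp] := atlas_cover p.1; have [d ad dp] := atlas_cover p.2.
by exists (prod_chart c d) => //; exists c => //; exists d.
Qed.

Lemma prod_atlas_compat c d : prod_atlas c -> prod_atlas d ->
  smooth_on (c @` (chart_dom c `&` chart_dom d)) (d \o chart_inv c).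
Proof.
move=> [c1 a1 [c2 a2 <-]] [d1 b1 [d2 b2 <-]] k; set U := _ @` _.
have oU : open U by apply: chart_open; exact: chart_dom_open.
have idC : Ck k U (@id 'rV[R]_(m + n)).
  by apply: (@Ck_lin R _ _ k U idfun) => x; exact: cvg_id.
apply: Ck_row_mx => //.
  have Cl := Ck_lsubmx oU idC.
  apply: (Ck_comp (g := d1 \o chart_inv c1) oU _ Cl (atlas_compat _ _ a1 b1 k)).
  by move=> _ [[x y] [[/= cx cy] [/= dx dy]] <-]; exists x => //; rewrite row_mxKl.
have Cr := Ck_rsubmx oU idC.
apply: (Ck_comp (g := d2 \o chart_inv c2) oU _ Cr (atlas_compat _ _ a2 b2 k)).
by move=> _ [[x y] [[/= cx cy] [/= dx dy]] <-]; exists y => //; rewrite row_mxKr.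
Qed.

HB.instance Definition _ := Topological_isManifold.Build R (m + n) (M * N)%type
  prod_atlas_cover prod_atlas_compat
  (prod_hausdorff (@manifold_hausdorff R m M) (@manifold_hausdorff R n N))
  (prod_second_countable (@manifold_second_countable R m M)
    (@manifold_second_countable R n N)).

End ProdManifold.

Section SmoothPair.
Context {R : realType} {m n p : nat}.
Context (M : manifoldType R m) (N : manifoldType R n) (P : manifoldType R p).

Lemma smooth_map_fst : smooth_map (@fst M N).
Proof.
split=> [q|c d [c1 a1 [c2 a2 <-]] ad k]; first exact: cvg_fst.
set U := _ @` _.
have oU : open U.
  apply: chart_open; apply: open_comp; last exact: chart_dom_open.
  by move=> q _; exact: cvg_fst.
have idC : Ck k U (@id 'rV[R]_(m + n)).
  by apply: (@Ck_lin R _ _ k U idfun) => x; exact: cvg_id.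
have Cl := Ck_lsubmx oU idC.
apply: (Ck_comp (g := d \o chart_inv c1) oU _ Cl (atlas_compat _ _ a1 ad k)).
by move=> _ [[x y] [[/= cx cy] dx] <-]; exists x => //; rewrite row_mxKl.
Qed.

Lemma smooth_map_snd : smooth_map (@snd M N).
Proof.
split=> [q|c d [c1 a1 [c2 a2 <-]] ad k]; first exact: cvg_snd.
set U := _ @` _.
have oU : open U.
  apply: chart_open; apply: open_comp; last exact: chart_dom_open.
  by move=> q _; exact: cvg_snd.
have idC : Ck k U (@id 'rV[R]_(m + n)).
  by apply: (@Ck_lin R _ _ k U idfun) => x; exact: cvg_id.
have Cr := Ck_rsubmx oU idC.
apply: (Ck_comp (g := d \o chart_inv c2) oU _ Cr (atlas_compat _ _ a2 ad k)).
by move=> _ [[x y] [[/= cx cy] dy] <-]; exists y => //; rewrite row_mxKr.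
Qed.

Lemma smooth_map_pair (f : P -> M) (g : P -> N) :
  smooth_map f -> smooth_map g ->
  smooth_map ((fun x => (f x, g x)) : P -> (M * N)%type).
Proof.
move=> [cf sf] [cg sg].
have cfg : continuous ((fun x => (f x, g x)) : P -> (M * N)%type).
  by move=> x; exact: cvg_pair (cf x) (cg x).
split=> // c d ac [d1 b1 [d2 b2 <-]] k; set U := _ @` _.
have oU : open U.
  apply: chart_open; apply: open_comp; last exact: chart_dom_open.
  by move=> x _; exact: cfg.
apply: Ck_row_mx => //.
  by apply: Ck_sub (sf c d1 ac b1 k) => _ [x [cx [/= dx _]] <-]; exists x.
by apply: Ck_sub (sg c d2 ac b2 k) => _ [x [cx [/= _ dx]] <-]; exists x.
Qed.

End SmoothPair.

HB.mixin Record Manifold_isLieGroup (R : realType) (n : nat) (G : Type)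
    of Manifold R n G & Group G := {
  mulg_smooth : smooth_map ((fun p => p.1 * p.2)%g : (G * G)%type -> G);
  invg_smooth : smooth_map ((fun x => x^-1)%g : G -> G) }.

#[short(type="lieGroupType")]
HB.structure Definition LieGroup (R : realType) (n : nat) :=
  {G of Manifold R n G & Group G & Manifold_isLieGroup R n G}.

Definition Ad (G : groupType) (g h : G) : G := (g * h * g^-1)%g.

Section SmoothGroup.
Context {R : realType} {n m : nat} (G : lieGroupType R n) (M : manifoldType R m).

Lemma smooth_mulg (f g : M -> G) : smooth_map f -> smooth_map g ->
  smooth_map ((fun x => f x * g x)%g : M -> G).
Proof.
by move=> sf sg; apply: smooth_map_comp (smooth_map_pair sf sg) mulg_smooth.
Qed.

Lemma smooth_invg (f : M -> G) : smooth_map f ->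
  smooth_map ((fun x => (f x)^-1)%g : M -> G).
Proof. by move=> sf; apply: smooth_map_comp sf invg_smooth. Qed.

Lemma smooth_Ad (f g : M -> G) : smooth_map f -> smooth_map g ->
  smooth_map (fun x => Ad (f x) (g x)).
Proof.
by move=> sf sg; apply: smooth_mulg; [exact: smooth_mulg|exact: smooth_invg].
Qed.

End SmoothGroup.

(* G |> G: the manifold G x G with the product
   (g1, h1) (g2, h2) = (g1 g2, h1 Ad_{g1} h2). *)
Definition adprod (G : Type) := (G * G)%type.

HB.instance Definition _ (R : realType) (n : nat) (G : manifoldType R n) :=
  Manifold.copy (adprod G) (G * G)%type.

Section AdProdGroup.
Local Open Scope group_scope.
Context {G : groupType}.
Implicit Types x y z : adprod G.

HB.instance Definition _ := Choice.copy (adprod G) (G * G)%type.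

Definition adprod_one : adprod G := (1, 1).
Definition adprod_mul x y : adprod G := (x.1 * y.1, x.2 * Ad x.1 y.2).
Definition adprod_inv x : adprod G := (x.1^-1, Ad x.1^-1 x.2^-1).

Fact adprod_mulA : associative adprod_mul.
Proof.
move=> [a b] [c d] [e f]; congr (_, _); first exact: mulgA.
by rewrite /= /Ad invgM !mulgA mulgVK.
Qed.

Fact adprod_mul1 : left_id adprod_one adprod_mul.
Proof. by case=> g h; rewrite /adprod_mul /Ad /= invg1 !mulg1 !mul1g. Qed.

Fact adprod_mulr1 : right_id adprod_one adprod_mul.
Proof. by case=> g h; rewrite /adprod_mul /Ad /= !mulg1 mulgV mulg1. Qed.

Fact adprod_mulV : left_inverse adprod_one adprod_inv adprod_mul.
Proof.
case=> g h; congr (_, _); first exact: mulVg.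
by rewrite /= /Ad invgK !mulgA mulgK mulgVK mulVg.
Qed.

Fact adprod_mulrV : right_inverse adprod_one adprod_inv adprod_mul.
Proof.
case=> g h; congr (_, _); first exact: mulgV.
by rewrite /= /Ad invgK !mulgA mulgK mulgK mulgV.
Qed.

HB.instance Definition _ := isGroup.Build (adprod G)
  adprod_mulA adprod_mul1 adprod_mulr1 adprod_mulV adprod_mulrV.

End AdProdGroup.

Section AdProdLie.
Context {R : realType} {n : nat} (G : lieGroupType R n).

Let sfst : smooth_map (fst : adprod G -> G). Proof. exact: smooth_map_fst. Qed.
Let ssnd : smooth_map (snd : adprod G -> G). Proof. exact: smooth_map_snd. Qed.

Lemma adprod_mul_smooth : smooth_map
  ((fun p => p.1 * p.2)%g : (adprod G * adprod G)%type -> adprod G).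
Proof.
have s1 := @smooth_map_fst R _ _ (adprod G) (adprod G).
have s2 := @smooth_map_snd R _ _ (adprod G) (adprod G).
have s11 := smooth_map_comp s1 sfst; have s12 := smooth_map_comp s1 ssnd.
have s21 := smooth_map_comp s2 sfst; have s22 := smooth_map_comp s2 ssnd.
exact: smooth_map_pair (smooth_mulg s11 s21) (smooth_mulg s12 (smooth_Ad s11 s22)).
Qed.

Lemma adprod_inv_smooth : smooth_map ((fun x => x^-1)%g : adprod G -> adprod G).
Proof.
exact: smooth_map_pair (smooth_invg sfst)
  (smooth_Ad (smooth_invg sfst) (smooth_invg ssnd)).
Qed.

HB.instance Definition _ := Manifold_isLieGroup.Build R (n + n) (adprod G)
  adprod_mul_smooth adprod_inv_smooth.

End AdProdLie.

Definition rota_baxter (R : realType) (n : nat) (G : lieGroupType R n)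
    (B : G -> G) :=
  smooth_map B /\
  forall g h : G, (B g * B h = B (g * Ad (B g) h))%g.

(* A Lie subgroup is a subset that is the image of an injective immersion of a
   Lie group which is a group morphism, i.e. a subgroup endowed with a Lie group
   structure making it an immersed submanifold. It need not be closed; since
   manifolds are second countable, discrete topologies on uncountable subgroups
   are excluded. *)
Definition lie_subgroup (R : realType) (k : nat) (K : lieGroupType R k)
    (S : set K) :=
  exists (m : nat) (H : lieGroupType R m) (f : H -> K),
    [/\ {morph f : x y / (x * y)%g}, injective f, immersion f & range f = S].

Definition RB_graph (G : Type) (B : G -> G) : set (adprod G) :=
  [set (B g, g) | g in [set: G]].

(* Main.v *)
From HB Require Import structures.
Require Import Defs.
From mathcomp Require Import all_boot all_order all_algebra.
From mathcomp Require Import all_classical all_reals all_analysis.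
Import numFieldNormedType.Exports.

(** If the graph of [B] is a subgroup, the product
      [(B g, g) (B h, h) = (B g * B h, g * Ad (B g) h)]
    lies on it, which says exactly that [B g * B h = B (g * Ad (B g) h)].

    Conversely, assume the Rota-Baxter identity.  The bijection
    [g |-> (B g, g)] from [G] onto the graph transports the group law of the
    graph to the descendent product [g o h := g * Ad (B g) h] on the manifold
    [G]; this is a group law because the identity makes the graph closed under
    products and inverses ([rota_baxterV]), and it is smooth because [B] and the
    operations of [G] are.  Hence [G] with this product is a Lie group
    ([descendent]), and [g |-> (B g, g)] is an injective smooth morphism onto
    the graph.  It is an immersion because the second projection is a smooth
    left inverse of it ([immersion_of_retraction]). *)

Set Implicit Arguments.
Unset Strict Implicit.
Unset Printing Implicit Defensive.

Local Open Scope classical_set_scope.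

Section Retraction.
Local Open Scope ring_scope.
Context {R : realType}.

Lemma smooth_at_differentiable (V W : normedModType R) (U : set V)
  (f : V -> W) x : smooth_on U f -> U x -> differentiable f x.
Proof. move=> sf Ux; have [df _] := sf 1%N; exact: df. Qed.

(** Differentiating [g \o f = id] with the chain rule gives a left inverse of
    the differential of [f]. *)
Lemma diff_inj_of_retraction (V W : normedModType R) (f : V -> W) (g : W -> V)
    (x : V) : (\forall y \near x, g (f y) = y) ->
  differentiable f x -> differentiable g (f x) -> injective ('d f x).
Proof.
move=> gf df dg; apply: (can_inj (g := 'd g (f x))) => v.
have dgf : differentiable (g \o f) x by exact: differentiable_comp.
have [_ E] := @is_diff_near R V V (g \o f) id x gf dgf.
have di : ('d (@id V) x : V -> V) v = v.
  by rewrite (@diff_lin R V V idfun)// => y; exact: cvg_id.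
by rewrite -[RHS]di E (diff_comp df dg).
Qed.

Lemma immersion_of_retraction m n (M : manifoldType R m) (N : manifoldType R n)
    (f : M -> N) (g : N -> M) :
  smooth_map f -> smooth_map g -> cancel f g -> immersion f.
Proof.
move=> sf [cg sg] gf; split=> // c d x ac ad cx dfx.
have [cf sfcd] := sf.
(* [g] read in the charts [d] and [c], the ones [f] is read in *)
apply: (@diff_inj_of_retraction _ _ _ (c \o g \o chart_inv d)).
- have od : open (c @` (chart_dom c `&` f @^-1` chart_dom d)).
    apply: chart_open; apply: open_comp; last exact: chart_dom_open.
    by move=> y _; exact: cf.
  have Ux : (c @` (chart_dom c `&` f @^-1` chart_dom d)) (c x) by exists x.
  apply: filterS (open_nbhs_nbhs (conj od Ux)) => _ [y [cy dy] <-] /=.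
  by rewrite chartK// chartK// gf.
- by apply: smooth_at_differentiable (sfcd c d ac ad) _; exists x.
- apply: smooth_at_differentiable (sg d c ad ac) _.
  by rewrite /= chartK//; exists (f x) => //; split=> //; rewrite /= gf.
Qed.

End Retraction.

(** The proof [rb] is a parameter of the type so that the group structure can
    be inferred from it. *)
Definition descendent (R : realType) (n : nat) (G : lieGroupType R n)
  (B : G -> G) (rb : rota_baxter B) : Type := G.

HB.instance Definition _ (R : realType) (n : nat) (G : lieGroupType R n)
  (B : G -> G) (rb : rota_baxter B) :=
  Manifold.copy (descendent rb) (G : manifoldType R n).

Section Descendent.
Local Open Scope group_scope.
Context {R : realType} {n : nat} {G : lieGroupType R n} {B : G -> G}.

Definition graph_map (g : G) : adprod G := (B g, g).

Lemma graph_map_inj : injective graph_map.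
Proof. by move=> g h []. Qed.

Definition descendent_mul (g h : G) : G := g * Ad (B g) h.
Definition descendent_inv (g : G) : G := Ad (B g)^-1 g^-1.

Hypothesis rb : rota_baxter B.

Lemma graph_mapM (g h : G) :
  graph_map (descendent_mul g h) = graph_map g * graph_map h.
Proof. by case: rb => _ rbM; congr (_, _); rewrite -rbM. Qed.

(** [B 1] is idempotent in the group [G]. *)
Lemma rota_baxter1 : B 1 = 1.
Proof.
case: rb => _ /(_ 1 1); rewrite /Ad mulg1 mulgV mulg1 => E.
by apply: (mulgI (B 1)); rewrite E mulg1.
Qed.

Lemma graph_map1 : graph_map 1 = 1.
Proof. by rewrite /graph_map rota_baxter1. Qed.

(** The product [g o descendent_inv g] is [1] already in [G], so applying [B]
    shows that the graph is closed under inverses. *)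
Lemma rota_baxterV (g : G) : B (descendent_inv g) = (B g)^-1.
Proof.
case: rb => _ rbM; apply: (mulgI (B g)); rewrite rbM mulgV -rota_baxter1.
by congr B; rewrite /descendent_inv /Ad invgK !mulgA !mulgK mulgV.
Qed.

Lemma graph_mapV (g : G) : graph_map (descendent_inv g) = (graph_map g)^-1.
Proof. by rewrite /graph_map rota_baxterV. Qed.

(* The group axioms are those of [adprod G], pulled back along [graph_map]. *)
Fact descendent_mulA : associative descendent_mul.
Proof. by move=> x y z; apply: graph_map_inj; rewrite !graph_mapM mulgA. Qed.

Fact descendent_mul1g : left_id 1 descendent_mul.
Proof. by move=> x; apply: graph_map_inj; rewrite graph_mapM graph_map1 mul1g. Qed.

Fact descendent_mulg1 : right_id 1 descendent_mul.
Proof. by move=> x; apply: graph_map_inj; rewrite graph_mapM graph_map1 mulg1. Qed.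

Fact descendent_mulVg : left_inverse 1 descendent_inv descendent_mul.
Proof.
by move=> x; apply: graph_map_inj; rewrite graph_mapM graph_mapV graph_map1 mulVg.
Qed.

Fact descendent_mulgV : right_inverse 1 descendent_inv descendent_mul.
Proof.
by move=> x; apply: graph_map_inj; rewrite graph_mapM graph_mapV graph_map1 mulgV.
Qed.

HB.instance Definition _ := isGroup.Build (descendent rb)
  descendent_mulA descendent_mul1g descendent_mulg1
  descendent_mulVg descendent_mulgV.

Fact descendent_mul_smooth : smooth_map ((fun p => p.1 * p.2) :
  (descendent rb * descendent rb)%type -> descendent rb).
Proof.
have [sB _] := rb.
have s1 := @smooth_map_fst R _ _ G G; have s2 := @smooth_map_snd R _ _ G G.
exact: smooth_mulg s1 (smooth_Ad (smooth_map_comp s1 sB) s2).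
Qed.

Fact descendent_inv_smooth :
  smooth_map ((fun x => x^-1) : descendent rb -> descendent rb).
Proof.
have [sB _] := rb.
exact: smooth_Ad (smooth_invg sB) (smooth_invg (smooth_map_id G)).
Qed.

HB.instance Definition _ := Manifold_isLieGroup.Build R n (descendent rb)
  descendent_mul_smooth descendent_inv_smooth.

Lemma graph_map_immersion : immersion (graph_map : descendent rb -> adprod G).
Proof.
have [sB _] := rb.
apply: (@immersion_of_retraction R _ _ _ _ _ snd) => //.
  exact: smooth_map_pair sB (smooth_map_id G).
exact: smooth_map_snd.
Qed.

Lemma lie_subgroup_graph : lie_subgroup (RB_graph B).
Proof.
exists n, (descendent rb), graph_map; split=> //.
- exact: graph_mapM.
- exact: graph_map_inj.
- exact: graph_map_immersion.
Qed.

End Descendent.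

Theorem proposition2p13 (R : realType) (n : nat) (G : lieGroupType R n)
    (B : G -> G) (smoothB : smooth_map B) :
  rota_baxter B <-> lie_subgroup (RB_graph B).
Proof.
split=> [rb|[m [H [f [fM _ _ fG]]]]]; first exact: lie_subgroup_graph.
split=> // g h.
have [x _ fx] : range f (B g, g) by rewrite fG; exists g.
have [y _ fy] : range f (B h, h) by rewrite fG; exists h.
have : RB_graph B (f (x * y)%g) by rewrite -fG; exists (x * y)%g.
by rewrite fM fx fy => -[k _ [<- <-]].
Qed.
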